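(* Let $p$ be a prime, let $d\ge2$, and let $P^\perp$ and $Q^\perp$ be linear cellular automaton shifts over $\mathbb F_p$ in $d$ variables, given by $P=X_d-\Phi(X_1,\ldots,X_{d-1})$ and $Q=X_d-\Psi(X_1,\ldots,X_{d-1})$. If $P\neq Q$, then every topological homomorphism $\phi\colon P^\perp\to Q^\perp$ is trivial, i.e. $\phi(x)=0$ for all $x\in P^\perp$.
   Context: Identify $(c_{\mathbf n})_{\mathbf n\in\mathbb Z^d}\in\mathbb F_p^{\mathbb Z^d}$ with the formal (two-sided) Laurent series $\sum_{\mathbf n\in\mathbb Z^d}c_{\mathbf n}X^{\mathbf n}$, where $X^{\mathbf n}=X_1^{n_1}\cdots X_d^{n_d}$. The set $\mathbb F_p[[X_1^{\pm1},\ldots,X_d^{\pm1}]]$ of all such series, with the product topology ($\mathbb F_p$ discrete), is a compact abelian group and a module over the ring $\mathbb F_p[X_1^{\pm1},\ldots,X_d^{\pm1}]$ of Laurent polynomials. The group $\mathbb Z^d$ acts by $T_{\mathbf n}x=X^{\mathbf n}x$; the shift $\sigma_i$ is multiplication by $X_i^{-1}$. For a Laurent polynomial $P$, $P^\perp=\{x\in\mathbb F_p[[X_1^{\pm1},\ldots,X_d^{\pm1}]]: Px=0\}$, a closed submodule. $P^\perp$ is a linear cellular automaton shift if $P=X_d-\Phi(X_1,\ldots,X_{d-1})$, where $\Phi$ is a Laurent polynomial in $X_1,\ldots,X_{d-1}$ over $\mathbb F_p$ with at least two non-zero terms. A homomorphism $\phi\colon P^\perp\to Q^\perp$ is a $\mathbb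 Z^d$-equivariant map with $\phi(0)=0$ (not assumed additive); it is a topological homomorphism if it is continuous. *)

(* Defs.v *)
From HB Require Import structures.
From mathcomp Require Import all_boot all_order all_algebra finmap.
From mathcomp Require Import all_classical topology.
From mathcomp.multinomials Require Import monalg.

Set Implicit Arguments.
Unset Strict Implicit.
Unset Printing Implicit Defensive.

Import GRing.Theory.
Local Open Scope ring_scope.

(* Only the additive group of Laurent polynomials is used: the library's product
   on {malg _[_]} needs a monoid of exponents without units, unlike Z^d. The
   coefficient of X^n in P is P@_n, and c X^n is << c *g n >>. *)
Notation laurent p d := {malg 'F_p['rV[int]_d]}.

Definition monomial (p d : nat) (n : 'rV[int]_d) : laurent p d := << 1 *g n >>.

Definition series (p d : nat) : Type := 'rV[int]_d -> 'F_p.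

HB.instance Definition _ (p d : nat) :=
  GRing.Zmodule.copy (series p d) ('rV[int]_d -> 'F_p).
HB.instance Definition _ (p d : nat) :=
  Topological.copy (series p d) {ptws 'rV[int]_d -> discrete_topology 'F_p}.

Definition lmul (p d : nat) (P : laurent p d) (x : series p d) : series p d :=
  fun n => \sum_(k <- msupp P) P@_k * x (n - k).

(* T_n : x |-> X^n x. *)
Definition translate (p d : nat) (n : 'rV[int]_d) (x : series p d) : series p d :=
  lmul (monomial p n) x.

Definition perp (p d : nat) (P : laurent p d) : set (series p d) :=
  [set x | lmul P x = 0].

Lemma translateE p d (n : 'rV[int]_d) (x : series p d) m :
  translate n x m = x (m - n).
Proof.
rewrite /translate /lmul /monomial msuppU oner_eq0 big_seq_fset1.
by rewrite mcoeffUU mul1r.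
Qed.

Lemma lmul_translate p d (P : laurent p d) n (x : series p d) :
  lmul P (translate n x) = translate n (lmul P x).
Proof.
apply/funext => m; rewrite translateE /lmul.
by apply: eq_bigr => k _; rewrite translateE addrAC.
Qed.

Lemma perp_translate p d (P : laurent p d) n (x : series p d) :
  x \in perp P -> translate n x \in perp P.
Proof.
rewrite !inE /perp /= lmul_translate => ->.
by apply/funext => m; rewrite translateE.
Qed.

Lemma perp_0 p d (P : laurent p d) : (0 : series p d) \in perp P.
Proof.
rewrite inE /perp /=; apply/funext => m.
by rewrite /lmul big1 // => k _; rewrite mulr0.
Qed.

Definition perp0 (p d : nat) (P : laurent p d) : perp P := exist _ 0 (perp_0 P).

Definition perp_act (p d : nat) (P : laurent p d) (n : 'rV[int]_d)
  (x : perp P) : perp P := exist _ (translate n (sval x)) (perp_translate n (svalP x)).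

(* [set_type] carries the subspace topology, so [continuous] is continuity for
   the topologies induced on [perp P] and [perp Q] by the product topology. *)
Definition topological_hom (p d : nat) (P Q : laurent p d)
  (phi : perp P -> perp Q) : Prop :=
  [/\ continuous phi,
      forall n x, phi (perp_act n x) = perp_act n (phi x)
    & phi (perp0 P) = perp0 Q].

(* X_1^n_1 ... X_(d-1)^n_(d-1) as a monomial in d variables: X_d gets exponent 0. *)
Definition widen_exp (d : nat) (n : 'rV[int]_d.-1) : 'rV[int]_d :=
  \row_(i < d) if insub (val i) is Some j then n 0 j else 0.

Definition widen_laurent (p d : nat) (Phi : laurent p d.-1) : laurent p d :=
  \sum_(k <- msupp Phi) << Phi@_k *g widen_exp k >>.

(* The exponent of X_d: variables are indexed from 0. *)
Definition last_exp (d : nat) : 'rV[int]_d := \row_(i < d) (val i == d.-1)%:R.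

(* X_d - Phi(X_1, ..., X_(d-1)). *)
Definition ca_poly (p d : nat) (Phi : laurent p d.-1) : laurent p d :=
  monomial p (last_exp d) - widen_laurent Phi.

(* Main.v *)
Require Import Defs.
From HB Require Import structures.
From mathcomp Require Import all_boot all_order all_algebra finmap.
From mathcomp Require Import finfield zify.
From mathcomp Require Import all_classical topology.
From mathcomp.multinomials Require Import monalg.

(** Read a series as a sequence of rows, indexed by the exponent of [X_d].
    Lying in [perp (X_d - Phi)] means that each row is [Phi] times the row of
    index one more.  Write [last] for the exponent of [X_d], let [q = p^N], and
    let [phi] be as in the theorem.

    The first ingredient is the Frobenius map: over [F_p] one has
    [Phi(X)^q = Phi(X^q)], so every [x] in [perp (X_d - Phi)] satisfies
    [x(m - q last) = \sum_k Phi_k x(m - q k)] for all [m]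
    ([perp_ca_frobenius]).  The second is independence of far away regions:
    a row of an element of [perp (X_d - Phi)] can be prescribed arbitrarily
    ([perp_ca_extension], which rests on the surjectivity of multiplication by
    a nonzero Laurent polynomial, [convolution_surjective]), and it determines
    the rows of smaller index locally.  Hence, for finitely many [k], elements
    [x_k] of [perp (X_d - Phi)] and a finite window, some [x] looks like [x_k]
    in the window translated by [- q k] as soon as [q] is large
    ([perp_ca_gluing]).

    The value [f(x) = phi(x)(0)] depends, near each point, on the entries of
    [x] in a finite window ([continuous_finite_window]).  For the glued [x],
    the translate of [x] by [q k] has the same value of [f] as [x_k], and its
    translate by [q last] has the same value of [f] as [\sum_k Phi_k x_k].
    Comparing with the Frobenius relation for [phi(x)], which lies in
    [perp (X_d - Psi)], gives ([value_at0_sum])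
      [f(\sum_k Phi_k x_k) = \sum_k Psi_k f(x_k)]
    for arbitrary [x_k], where [k] runs over the union of the two supports.

    The rest is algebra ([value_at0_eq0]).  Taking a single nonzero [x_k],
    [f(Phi_k a) = Psi_k f(a)], so [f = 0] if exactly one of [Phi_k], [Psi_k]
    vanishes.  If [Phi_k] and [Psi_k] are distinct and nonzero, a second term of
    [Phi] shows that [f] is additive, hence [F_p]-linear, and
    [(Phi_k - Psi_k) f = 0].  Finally [f = 0] forces [phi = 0] by
    equivariance. *)

Set Implicit Arguments.
Unset Strict Implicit.
Unset Printing Implicit Defensive.

Import Order.TTheory GRing.Theory Num.Theory.
Local Open Scope ring_scope.

(** * The Frobenius map on recurrences *)

Lemma iter_binomial (V : zmodType) (A B : {additive V -> V}) n v :
  (forall u, A (B u) = B (A u)) ->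
  iter n (A \+ B) v =
  \sum_(i < n.+1) iter (n - i) A (iter i B v) *+ 'C(n, i).
Proof.
move=> AB.
have ABi i u : B (iter i A u) = iter i A (B u).
  by elim: i u => //= i IH u; rewrite -AB IH.
elim: n => [|n IH]; first by rewrite big_ord_recl big_ord0 addr0.
rewrite iterS IH /= !raddf_sum /=.
rewrite [in RHS]big_ord_recl subn0 bin0 /=.
rewrite big_ord_recl subn0 bin0 /= -addrA; congr (_ + _).
have -> :
  \sum_(i < n.+1)
    iter (n.+1 - bump 0 i) A (B (iter i B v)) *+ 'C(n.+1, bump 0 i)
  = \sum_(i < n.+1) iter (n - i) A (iter i.+1 B v) *+ 'C(n, i.+1)
    + \sum_(i < n.+1) iter (n - i) A (iter i.+1 B v) *+ 'C(n, i).
  rewrite -big_split /=; apply: eq_bigr => i _.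
  by rewrite /bump /= add1n subSS binS mulrnDr.
congr (_ + _).
  rewrite [RHS]big_ord_recr /= subnn bin_small // mulr0n addr0.
  apply: eq_bigr => i _; rewrite raddfMn /bump /= add1n.
  by rewrite -[A (iter _ A _)]iterS subnSK.
by apply: eq_bigr => i _; rewrite raddfMn ABi.
Qed.

(** The freshman's dream for commuting additive operators. *)
Lemma iter_prime_sum (V : zmodType) (p : nat) (I : Type) (s : seq I)
    (A : I -> {additive V -> V}) :
  prime p -> (forall v : V, v *+ p = 0) ->
  (forall i j v, A i (A j v) = A j (A i v)) ->
  forall v, iter p (fun u => \sum_(i <- s) A i u) v =
            \sum_(i <- s) iter p (A i) v.
Proof.
move=> p_prime charV AC v.
suff [g [gE <-]] : exists g : {additive V -> V},
    (forall u, g u = \sum_(i <- s) A i u) /\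
    iter p g v = \sum_(i <- s) iter p (A i) v.
  by apply: eq_iter => u; rewrite gE.
elim: s => [|i s [g [gE gp]]].
  exists \0; split=> [u|]; rewrite big_nil //.
  by case: p p_prime {charV} => [|q _] //.
exists (A i \+ g); split=> [u|]; first by rewrite big_cons /= gE.
rewrite iter_binomial; last first.
  by move=> u; rewrite !gE raddf_sum; apply: eq_bigr => j _; rewrite AC.
rewrite big_cons -gp.
case: p p_prime charV {gp} => [//|q] q_prime charV.
rewrite big_ord_recl big_ord_recr /= bin0 /bump /= add1n subnn binn !mulr1n.
rewrite big1 ?add0r // => j _; rewrite add1n.
have /dvdnP[r ->] : (q.+1 %| 'C(q.+1, j.+1))%N.
  by apply: prime_dvd_bin => //; rewrite /= ltnS ltn_ord.
by rewrite mulnC mulrnA charV mul0rn.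
Qed.

Section Frobenius.
Variables (p : nat) (p_prime : prime p) (G : zmodType).

(** The operator [v |-> c X^b v]. *)
Definition scaled_shift (c : 'F_p) (b : G) (v : G -> 'F_p) : G -> 'F_p :=
  fun m => c * v (m - b).

Lemma scaled_shift_additive c b : zmod_morphism (scaled_shift c b).
Proof. by move=> u v; apply/funext => m; rewrite /scaled_shift mulrBr. Qed.

HB.instance Definition _ c b :=
  GRing.isZmodMorphism.Build _ _ (scaled_shift c b) (scaled_shift_additive c b).

Lemma iter_scaled_shift c b n v m :
  iter n (scaled_shift c b) v m = c ^+ n * v (m - b *+ n).
Proof.
elim: n m => [|n IH] m; first by rewrite mul1r subr0.
by rewrite iterS {1}/scaled_shift IH mulrA -exprS mulrS opprD addrA.
Qed.

Lemma Fp_fermat (c : 'F_p) : c ^+ p = c.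
Proof. by rewrite -[in X in _ ^+ X](card_Fp p_prime) expf_card. Qed.

(** If [x] is killed by [X^a - \sum_i c_i X^(b_i)], then it is killed by the
    polynomial obtained from it by substituting [X^(p^n)] for [X]. *)
Lemma frobenius_recurrence (I : Type) (s : seq I) (c : I -> 'F_p) (b : I -> G)
    (a : G) (x : G -> 'F_p) :
  (forall m, x (m - a) = \sum_(i <- s) c i * x (m - b i)) ->
  forall n m, x (m - a *+ p ^ n) = \sum_(i <- s) c i * x (m - b i *+ p ^ n).
Proof.
move=> xP; elim=> [|n IH] m; first exact: xP.
pose A i := scaled_shift (c i) (b i *+ p ^ n).
pose E (u : G -> 'F_p) := \sum_(i <- s) A i u.
have iterE j m' : iter j E x m' = x (m' - a *+ p ^ n *+ j).
  elim: j m' => [|j IHj] m'; first by rewrite subr0.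
  rewrite iterS {1}/E fct_sumE mulrSr opprD addrA IH.
  by apply: eq_bigr => i _; rewrite {1}/A /scaled_shift IHj addrAC.
rewrite expnSr mulrnA -iterE.
rewrite (@iter_prime_sum _ _ _ s (fun i => A i : {additive _ -> _})) //.
- rewrite fct_sumE; apply: eq_bigr => i _.
  by rewrite iter_scaled_shift Fp_fermat mulrnA.
- move=> v; apply/funext => k.
  rewrite -[LHS]/((v *+ p) k) natmulfctE; rewrite -mulr_natr.
  by have := pchar_Fp p_prime; rewrite inE => /andP[_ /eqP->]; rewrite mulr0.
move=> i j v; apply/funext => k /=.
by rewrite /A /scaled_shift mulrCA addrAC.
Qed.

End Frobenius.

(** * Surjectivity of multiplication by a Laurent polynomial *)

(** Recursion on [mu]: [f y m] only looks at [y] where [mu] is smaller than at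
    [m]. The function [y0] only serves to start the iteration. *)
Lemma measure_fixpoint (G F : Type) (mu : G -> nat) (f : (G -> F) -> G -> F)
    (y0 : G -> F) :
  (forall y y' m, (forall m', (mu m' < mu m)%N -> y m' = y' m') ->
     f y m = f y' m) ->
  exists y, forall m, y m = f y m.
Proof.
move=> f_loc.
have stab : forall N N' m, (mu m < N)%N -> (mu m < N')%N ->
    iter N f y0 m = iter N' f y0 m.
  elim=> [|N IH] [|N'] m //= ltN ltN'.
  by apply: f_loc => m' lt_m'; apply: IH; lia.
exists (fun m => iter (mu m).+1 f y0 m) => m.
by apply: f_loc => m' lt_m'; apply: stab.
Qed.

Lemma exists_argmin (I : eqType) (s : seq I) (l : I -> int) :
  s <> [::] -> exists2 i, i \in s & forall j, j \in s -> l i <= l j.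
Proof.
elim: s => // i [|j s] IH _.
  by exists i; rewrite ?mem_head // => k; rewrite inE => /eqP->.
have [|k ks kmin] := IH; first by [].
have [lik|lki] := leP (l i) (l k).
  exists i; rewrite ?mem_head // => h; rewrite inE => /orP[/eqP-> //|/kmin].
  exact: le_trans.
exists k; first by rewrite inE ks orbT.
by move=> h; rewrite inE => /orP[/eqP->|/kmin //]; apply: ltW.
Qed.

(** Values of [y] may be chosen freely on a strip [0 <= l < l k1 - l k0]; the
    equations then determine [y] above the strip by solving for the term [k0] of
    least height, and below it by solving for the term [k1] of greatest
    height. *)
Lemma convolution_surjective_of_height (G : zmodType) (F : fieldType) (s : seq G)
    (c : G -> F) (l : {additive G -> int}) (z : G -> F) :
  s <> [::] -> uniq s -> {in s, forall k, c k != 0} -> {in s &, injective l} ->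
  exists y : G -> F, forall n, \sum_(k <- s) c k * y (n - k) = z n.
Proof.
move=> s0 us c0 linj.
have [k0 k0s k0min] := @exists_argmin G s l s0.
have [k1 k1s k1max] := @exists_argmin G s (fun k => - l k) s0.
have {}k1max k : k \in s -> l k <= l k1 by move/k1max; rewrite lerN2.
have k0lt k : k \in s -> k != k0 -> l k0 < l k.
  move=> ks kk0; rewrite lt_neqAle k0min // andbT.
  by apply: contra kk0 => /eqP e; apply/eqP; apply: linj.
have k1gt k : k \in s -> k != k1 -> l k < l k1.
  move=> ks kk1; rewrite lt_neqAle k1max // andbT.
  by apply: contra kk1 => /eqP e; apply/eqP; apply: linj.
pose L := l k1 - l k0.
have L0 : 0 <= L by rewrite subr_ge0 k1max.
(* The value of [y m] forced by the equation at [n = m + k']. *)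
pose solve k' (y : G -> F) m :=
  (c k')^-1 * (z (m + k') - \sum_(k <- s | k != k') c k * y (m + k' - k)).
pose f y m := if L <= l m then solve k0 y m else
  if l m < 0 then solve k1 y m else 0.
(* Zero on the strip, and growing away from it. *)
pose mu m : nat :=
    if L <= l m then (`|(l m - L)%R|%N).+1 else if l m < 0 then `|l m|%N else 0%N.
have [y yE] : exists y, forall m, y m = f y m.
  apply: (@measure_fixpoint _ _ mu _ (fun=> 0)) => y y' m eqy.
  rewrite /f /solve; move: eqy; rewrite {2}/mu.
  case: ifP => [Lm|_] eqy.
    congr (_ * (_ - _)); rewrite big_seq_cond [RHS]big_seq_cond.
    apply: eq_bigr => k /andP[ks kk0]; rewrite eqy // /mu raddfB raddfD /=.
    have := k0lt _ ks kk0; have := k1max _ ks; move: Lm L0; rewrite /L.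
    move: (l m) (l k) (l k0) (l k1) => lm lk lk0 lk1 *.
    by case: ifP => ?; [lia|case: ifP => ?; lia].
  case: ifP eqy => // m0 eqy.
  congr (_ * (_ - _)); rewrite big_seq_cond [RHS]big_seq_cond.
  apply: eq_bigr => k /andP[ks kk1]; rewrite eqy // /mu raddfB raddfD /=.
  have := k1gt _ ks kk1; have := k0min _ ks; move: m0 L0; rewrite /L.
  move: (l m) (l k) (l k0) (l k1) => lm lk lk0 lk1 *.
  by case: ifP => ?; [lia|case: ifP => ?; lia].
have solveP k' n : k' \in s -> y (n - k') = solve k' y (n - k') ->
    \sum_(k <- s) c k * y (n - k) = z n.
  move=> ks e; rewrite (bigD1_seq k') //= e /solve mulrA divff ?c0 // mul1r.
  by rewrite subrK; apply: subrK.
exists y => n; have [ge|lt] := leP (l k1) (l n).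
  apply: (solveP k0) => //; rewrite yE /f raddfB /=.
  by rewrite (_ : L <= _ = true) //; rewrite /L lerD2r.
apply: (solveP k1) => //; rewrite yE /f raddfB /= ifF; last first.
  by apply/negbTE; rewrite -ltNge (lt_le_trans _ L0) // subr_lt0.
by rewrite subr_lt0 lt.
Qed.

Lemma exists_nat_nonroot (Q : {poly int}) :
  Q != 0 -> exists B : nat, Q.[B%:R] != 0.
Proof.
move=> Q0; pose rs : seq int := [seq i%:R | i <- iota 0 (size Q)].
have : ~~ all (root Q) rs.
  apply/negP => allr; have := max_poly_roots Q0 allr.
  rewrite map_inj_uniq ?iota_uniq ?size_map ?size_iota ?ltnn; last first.
    by move=> i j /eqP; rewrite eqr_nat => /eqP.
  by move/(_ isT).
by rewrite -has_predC => /hasP[_ /mapP[B _ ->] /= ?]; exists B.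
Qed.

(** [l v] is the value at some integer [B] of the polynomial with coefficient
    vector [v], where [B] avoids the roots of the polynomials attached to the
    nonzero differences of elements of [s]. *)
Lemma exists_injective_height (d : nat) (s : seq 'rV[int]_d) :
  exists l : {additive 'rV[int]_d -> int}, {in s &, injective l}.
Proof.
pose D := [seq k - k' | k <- s, k' <- s].
pose Q := \prod_(v <- D | v != 0) rVpoly v.
have rVpoly_eq0 (v : 'rV[int]_d) : (rVpoly v == 0) = (v == 0).
  by rewrite -(inj_eq (can_inj (@rVpolyK _ _))) linear0.
have Q0 : Q != 0.
  by rewrite prodf_seq_neq0; apply/allP => v _; rewrite rVpoly_eq0; apply/implyP.
have [B QB] := exists_nat_nonroot Q0.
pose l (v : 'rV[int]_d) := (rVpoly v).[B%:R].
have lB : zmod_morphism l by move=> u v; rewrite /l linearB /= hornerD hornerN.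
pose l' : {additive 'rV[int]_d -> int} :=
  HB.pack l (GRing.isZmodMorphism.Build _ _ l lB).
exists l' => k k' ks k's e.
apply/eqP; rewrite -subr_eq0; apply: contraR QB => kk'.
rewrite /Q horner_prod (big_rem (k - k')) /=; last first.
  by apply/allpairsP; exists (k, k').
have lkk' : l (k - k') = 0 by have := raddfB l' k k'; rewrite e subrr.
by rewrite kk' -/(l _) lkk' mul0r.
Qed.

Lemma convolution_surjective (d : nat) (F : fieldType) (s : seq 'rV[int]_d)
    (c : 'rV[int]_d -> F) (z : 'rV[int]_d -> F) :
  s <> [::] -> uniq s -> {in s, forall k, c k != 0} ->
  exists y : 'rV[int]_d -> F, forall n, \sum_(k <- s) c k * y (n - k) = z n.
Proof.
move=> s0 us c0; have [l linj] := exists_injective_height s.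
exact: convolution_surjective_of_height linj.
Qed.

(** * Rows of a cellular automaton shift *)

(** Provides the additivity of [lmul] in the polynomial. *)
Lemma lmulE p d (P : laurent p d) (x : series p d) n :
  lmul P x n = mmap idfun (fun k => x (n - k)) P.
Proof. by []. Qed.

Section Sites.
Variable e : nat.
Implicit Types (n k : 'rV[int]_e) (m : 'rV[int]_e.+1).

(** [widen_exp], with its additive structure. *)
Definition widen n : 'rV[int]_e.+1 := @widen_exp e.+1 n.

Lemma widen_zmod_morphism : zmod_morphism widen.
Proof.
move=> n k; apply/rowP => i; rewrite !mxE.
by case: insub => [j|]; rewrite ?mxE ?subr0.
Qed.

HB.instance Definition _ :=
  GRing.isZmodMorphism.Build _ _ widen widen_zmod_morphism.

(** The exponent whose first [e] entries are [n] and whose last entry is [t]. *)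
Definition site n (t : int) : 'rV[int]_e.+1 := widen n + last_exp e.+1 *~ t.

Lemma site_widen n t k : site n t - widen k = site (n - k) t.
Proof. by rewrite /site raddfB /= addrAC. Qed.

Lemma site_last n t : site n t - last_exp e.+1 = site n (t - 1).
Proof. by rewrite /site mulrzBr mulr1z addrA. Qed.

(** The first [e] entries and the last entry of an exponent. *)
Definition base_part m : 'rV[int]_e := \row_j m 0 (widen_ord (leqnSn e) j).
Definition time_part m : int := m 0 ord_max.

Lemma mulrz_row d (v : 'rV[int]_d) (t : int) i j : (v *~ t) i j = v i j * t.
Proof.
by case: t => t;
  rewrite ?NegzE ?mulrNz -pmulrn ?mxE mulmxnE ?mulrN -natz mulr_natr.
Qed.

Lemma base_partK n t : base_part (site n t) = n.
Proof.
apply/rowP => j; rewrite !mxE mulrz_row !mxE /=.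
rewrite (ltn_eqF (ltn_ord j)) mul0r addr0.
by case: insubP => [i _ /val_inj ->|/negP[]] //=.
Qed.

Lemma time_partK n t : time_part (site n t) = t.
Proof.
rewrite /time_part !mxE mulrz_row !mxE /= eqxx mul1r insubF ?add0r //.
by rewrite ltnn.
Qed.

Lemma siteK m : site (base_part m) (time_part m) = m.
Proof.
apply/rowP => i; rewrite !mxE mulrz_row !mxE /=.
have [i_e|e_i] := ltnP i e.
  rewrite insubT /= mxE (ltn_eqF i_e) mul0r addr0; congr (m 0 _).
  exact/val_inj.
have ie : i = ord_max by apply/val_inj/eqP; rewrite eqn_leq e_i -ltnS ltn_ord.
by rewrite ie insubF ?ltnn //= eqxx add0r mul1r.
Qed.

(** The l^1 norm. *)
Definition nrm n : nat := (\sum_i `|(n 0%R i)%R|)%N.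

Lemma nrmB n k : (nrm (n - k) <= nrm n + nrm k)%N.
Proof.
by rewrite -big_split; apply: leq_sum => i _; rewrite !mxE /=; lia.
Qed.

Lemma nrm_mulrn n q : nrm (n *+ q) = (nrm n * q)%N.
Proof.
rewrite /nrm big_distrl; apply: eq_bigr => i _.
by rewrite mulmxnE -mulr_natr abszM natz.
Qed.

Lemma nrm_eq0 n : (nrm n == 0%N) = (n == 0).
Proof.
rewrite sum_nat_eq0; apply/forallP/eqP => [h|-> i]; last by rewrite mxE.
by apply/rowP => i; rewrite mxE; apply/eqP; rewrite -absz_eq0; exact: h.
Qed.

End Sites.

Section CAShift.
Variables (p e : nat) (Phi : laurent p e).
Notation P := (@ca_poly p e.+1 Phi).
Implicit Types x y : series p e.+1.

Lemma perp_caP x : perp P x <->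
  forall m, x (m - last_exp e.+1) =
            \sum_(k <- msupp Phi) Phi@_k * x (m - widen k).
Proof.
have lmulP m : lmul P x m =
    x (m - last_exp e.+1) - \sum_(k <- msupp Phi) Phi@_k * x (m - widen k).
  rewrite lmulE /ca_poly mmapB /monomial mmapU mul1r /widen_laurent; congr (_ - _).
  by rewrite raddf_sum; apply: eq_bigr => k _; rewrite [LHS]mmapU.
split=> [Px m|Px]; last by apply/funext => m; rewrite lmulP Px subrr.
by apply/eqP; rewrite -subr_eq0 -lmulP Px.
Qed.

Lemma perp_ca_siteP x : perp P x <->
  forall n t, x (site n (t - 1)) =
              \sum_(k <- msupp Phi) Phi@_k * x (site (n - k) t).
Proof.
split=> [/perp_caP Px n t|Px]; last apply/perp_caP => m.
  by rewrite -site_last Px; apply: eq_bigr => k _; rewrite site_widen.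
rewrite -(siteK m) site_last Px.
by apply: eq_bigr => k _; rewrite site_widen.
Qed.

Lemma perp_ca_frobenius (p_prime : prime p) x : perp P x -> forall n m,
  x (m - last_exp e.+1 *+ p ^ n) =
  \sum_(k <- msupp Phi) Phi@_k * x (m - widen (k *+ p ^ n)).
Proof.
move/perp_caP => Px n m; rewrite (frobenius_recurrence p_prime Px n m).
by apply: eq_bigr => k _; rewrite (raddfMn (@widen e)).
Qed.

Lemma perp_ca_sum (I : Type) (r : seq I) (c : I -> 'F_p)
    (xs : I -> series p e.+1) :
  (forall i, perp P (xs i)) -> perp P (fun m => \sum_(i <- r) c i * xs i m).
Proof.
move=> Pxs; apply/perp_caP => m.
under [RHS]eq_bigr do rewrite mulr_sumr.
rewrite exchange_big /=; apply: eq_bigr => i _.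
have /perp_caP-> := Pxs i; rewrite mulr_sumr.
by apply: eq_bigr => k _; rewrite mulrCA.
Qed.

(** The row of index [T] of an element of [perp P] is arbitrary. *)
Lemma perp_ca_extension (p_prime : prime p) (T : int) (y : 'rV[int]_e -> 'F_p) :
  msupp Phi != fset0 -> exists2 x, perp P x & forall n, x (site n T) = y n.
Proof.
move=> Phi0.
pose E (r : 'rV[int]_e -> 'F_p) n := \sum_(k <- msupp Phi) Phi@_k * r (n - k).
have [S SK] : {S & forall r, E (S r) = r}.
  apply: (@choice _ _ (fun r s => E s = r)) => r.
  have [|||s sr] := @convolution_surjective _ _ (msupp Phi) (fun k => Phi@_k) r.
  - move=> s0; move: Phi0 => /fset0Pn[k].
    by rewrite -[k \in _]/(k \in (_ : seq _)) s0.
  - exact: fset_uniq.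
  - by move=> k ks; rewrite mcoeff_neq0.
  by exists s; apply/funext.
(* The index is counted from [T]: negative rows come from the automaton, the
   others from a right inverse of it. *)
pose row (t : int) :=
  match t with Posz i => iter i S y | Negz i => iter i.+1 E y end.
have rowE t : row (t - 1) = E (row t).
  case: t => [[|i]|i].
  - by [].
  - by rewrite (_ : i.+1%:Z - 1 = i%:Z) ?[RHS]SK //; lia.
  by rewrite (_ : Negz i - 1 = Negz i.+1) //; lia.
exists (fun m => row (time_part m - T) (base_part m)); last first.
  by move=> n; rewrite time_partK base_partK subrr.
apply/perp_ca_siteP => n t; rewrite time_partK base_partK.
rewrite addrAC rowE /E; apply: eq_bigr => k _.
by rewrite time_partK base_partK.
Qed.

(** The row of index [T] on a ball of radius [R] determines the row of index
    [T - i] on the ball of radius [R - i * D]. *)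
Lemma perp_ca_local (D : nat) x y (T : int) (R : nat) :
  perp P x -> perp P y -> (forall k, k \in msupp Phi -> (nrm k <= D)%N) ->
  (forall n, (nrm n <= R)%N -> x (site n T) = y (site n T)) ->
  forall i n, (nrm n + i * D <= R)%N ->
    x (site n (T - i%:Z)) = y (site n (T - i%:Z)).
Proof.
move=> /perp_ca_siteP Px /perp_ca_siteP Py PhiD xy; elim=> [|i IH] n nR.
  by rewrite subr0; apply: xy; lia.
rewrite (_ : T - i.+1%:Z = T - i%:Z - 1) ?Px ?Py; last lia.
rewrite big_seq_cond [RHS]big_seq_cond; apply: eq_bigr => k /andP[/PhiD kD _].
by rewrite IH //; have := nrmB n k; lia.
Qed.

End CAShift.

(** * Gluing and continuity *)

Lemma perp_shift p d (P : laurent p d) (x : series p d) n :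
  perp P x -> perp P (fun m => x (m - n)).
Proof.
move=> Px; have := @perp_translate p d P n x.
rewrite !inE => /(_ Px); congr (perp P _).
by apply/funext => m; rewrite translateE.
Qed.

Section Gluing.
Variables (p e : nat) (p_prime : prime p) (Phi : laurent p e).
Notation P := (@ca_poly p e.+1 Phi).
Implicit Types x y : series p e.+1.

(** The translates of [x] by the [k *+ p ^ N] agree with arbitrary elements [xs k]
    on the window of radius [R]. *)
Lemma perp_ca_gluing (K : seq 'rV[int]_e) (xs : 'rV[int]_e -> series p e.+1)
    (R : nat) :
  msupp Phi != fset0 -> (forall k, perp P (xs k)) ->
  exists N x, perp P x /\ forall k, k \in K ->
    forall n t, (nrm n <= R)%N -> (`|t|%N <= R)%N ->
    x (site n t - widen (k *+ p ^ N)) = xs k (site n t).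
Proof.
move=> Phi0 Pxs.
pose D := (\sum_(k <- msupp Phi) nrm k)%N.
have DP k : k \in msupp Phi -> (nrm k <= D)%N.
  by move=> ks; rewrite /D (big_fsetD1 k) //= leq_addr.
(* The row of index [R] on the ball of radius [R'] determines the rows of index
   between [-R] and [R] on the ball of radius [R]. *)
pose R' := (R + 2 * R * D)%N; pose N := (2 * R').+1; pose q := (p ^ N)%N.
have q_gt : (2 * R' < q)%N.
  by apply: leq_trans (ltnW (ltn_expl N (prime_gt1 p_prime))).
(* Since [q > 2 R'], the balls of radius [R'] around the [- k *+ q] are
   disjoint, so that the filter in [y] keeps at most one value of [k]. *)
pose close (n k : 'rV[int]_e) := (nrm (n + k *+ q) <= R')%N.
pose y n := head 0 [seq xs k (site (n + k *+ q) R%:Z) | k <- K & close n k].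
have yE k n : k \in K -> (nrm n <= R')%N -> y (n - k *+ q) = xs k (site n R%:Z).
  move=> kK nR; rewrite /y.
  have : k \in [seq k' <- K | close (n - k *+ q) k'].
    by rewrite mem_filter kK /close subrK nR.
  have : forall k', k' \in [seq k' <- K | close (n - k *+ q) k'] -> k' = k.
    move=> k'; rewrite mem_filter /close => /andP[nR' _].
    apply/eqP; rewrite -subr_eq0 -nrm_eq0.
    have := nrmB (n - k *+ q + k' *+ q) n.
    rewrite (_ : n - k *+ q + k' *+ q - n = (k' - k) *+ q); last first.
      by rewrite mulrnBl -addrA addrC addrA subrK.
    rewrite nrm_mulrn.
    by case: (nrm (k' - k)) => // j; rewrite mulSn; lia.
  case: [seq k' <- K | _] => [//|k' s] /(_ k' (mem_head _ _)) -> _ /=.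
  by rewrite subrK.
have [x Px xT] := perp_ca_extension p_prime R%:Z y Phi0.
exists N, x; split=> // k kK n t nR tR.
pose x' m := x (m - widen (k *+ q)).
have Px' : perp P x' by exact: perp_shift.
have := @perp_ca_local p e Phi D x' (xs k) R%:Z R' Px' (Pxs k) DP.
have x'T n' : (nrm n' <= R')%N -> x' (site n' R%:Z) = xs k (site n' R%:Z).
  by move=> n'R; rewrite /x' site_widen xT yE.
move/(_ x'T `|(R%:Z - t)%R|%N n).
rewrite (_ : R%:Z - `|R%:Z - t|%N%:Z = t); last lia.
apply; rewrite /R' leq_add // leq_mul2r; apply/orP; right; lia.
Qed.

End Gluing.

Section Continuity.
Local Open Scope classical_set_scope.
Variables (p e : nat) (P Q : laurent p e.+1) (phi : perp P -> perp Q).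

(** Otherwise a sequence [v_R] agreeing with [u] on larger and larger windows,
    hence convergent to [u], would contradict continuity. *)
Lemma continuous_finite_window (u : perp P) : continuous phi ->
  exists R : nat, forall v : perp P,
    (forall n t, (nrm n <= R)%N -> (`|t|%N <= R)%N ->
      sval v (site n t) = sval u (site n t)) ->
    sval (phi v) 0 = sval (phi u) 0.
Proof.
move=> phi_cont; apply: contrapT => noR.
have {noR} vP R : exists v : perp P,
    (forall n t, (nrm n <= R)%N -> (`|t|%N <= R)%N ->
      sval v (site n t) = sval u (site n t)) /\
    sval (phi v) 0 <> sval (phi u) 0.
  apply: contrapT => nov; apply: noR; exists R => v agree.
  by apply: contrapT => ne; apply: nov; exists v.
have [v vR] := choice vP.
have v_cvg : (fun R => sval (v R)) @ \oo --> (sval u : series p e.+1).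
  apply/cvg_sup => m U [V [[W oW <-] Wu WU]]; apply: filterS WU _.
  exists (maxn (nrm (base_part m)) `|time_part m|%N) => // R /=.
  rewrite geq_max => /andP[mR tR].
  by move: Wu; rewrite /= /proj -(siteK m) (vR R).1.
have v_cvg' : v @ \oo --> u.
  move=> A [B [[C oC <-] Cu] BA]; apply: filterS BA _.
  by apply: (v_cvg C); exact: open_nbhs_nbhs.
have ev0 : continuous (fun x : series p e.+1 => x 0 : discrete_topology 'F_p).
  exact: (@proj_continuous _ (fun=> discrete_topology 'F_p) 0).
have : (fun R => sval (phi (v R)) 0 : discrete_topology 'F_p) @ \oo -->
       (sval (phi u) 0 : discrete_topology 'F_p).
  apply: (@cvg_comp _ _ _ (fun R => sval (phi (v R)))
    (fun x : series p e.+1 => x 0 : discrete_topology 'F_p)); last exact: ev0.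
  apply: (@cvg_comp _ _ _ (fun R => phi (v R)) sval); last
    exact: initial_continuous.
  exact: cvg_comp v_cvg' (phi_cont u).
move=> /discrete_cvg [R _ /(_ R (leqnn R))].
exact: (vR R).2.
Qed.
End Continuity.

(** * Rigidity *)

Lemma sum_msupp_sub p e (Phi : laurent p e) (K : {fset 'rV[int]_e})
    (g : 'rV[int]_e -> 'F_p) :
  (msupp Phi `<=` K)%fset ->
  \sum_(k <- msupp Phi) Phi@_k * g k = \sum_(k <- K) Phi@_k * g k.
Proof. exact: (@mmapEw _ _ _ idfun). Qed.

Lemma big_fset_two (T : choiceType) (V : nmodType) (K : {fset T})
    (g : T -> V) k1 k2 :
  k1 \in K -> k2 \in K -> k1 != k2 ->
  (forall k, k != k1 -> k != k2 -> g k = 0) ->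
  \sum_(k <- K) g k = g k1 + g k2.
Proof.
move=> k1K k2K k12 g0.
rewrite (big_fsetD1 k1) //= (big_fsetD1 k2) /=; last by rewrite !inE eq_sym k12.
rewrite big_seq big1 ?addr0 // => k; rewrite !inE => /and3P[kk2 kk1 _].
exact: g0.
Qed.

(** A member of [perp P] as an element of the subtype. *)
Definition perp_elt p d (P : laurent p d) x (Px : perp P x) : perp P :=
  SigSub (mem_set Px).

Section Rigidity.
Variables (p e : nat) (p_prime : prime p) (Phi Psi : laurent p e).
Notation P := (@ca_poly p e.+1 Phi).
Notation Q := (@ca_poly p e.+1 Psi).
Variable phi : perp P -> perp Q.
Hypotheses (Phi_terms : (2 <= #|` msupp Phi|)%N) (phi_hom : topological_hom phi).

Let K : {fset 'rV[int]_e} := (msupp Phi `|` msupp Psi)%fset.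

(** The map [x |-> phi(x)(0)], extended by [0] outside [perp P] so that it takes
    plain series as arguments. *)
Definition value_at0 (x : series p e.+1) : 'F_p :=
  oapp (fun u : perp P => sval (phi u) 0) 0 (insub x).

Lemma value_at0E (u : perp P) : value_at0 (sval u) = sval (phi u) 0.
Proof. by rewrite /value_at0 valK. Qed.

Lemma Phi_supp_neq0 : msupp Phi != fset0.
Proof. by rewrite -cardfs_gt0 (leq_trans _ Phi_terms). Qed.

(** The exponent [k] enters the left side through [Phi] and the right side
    through [Psi]; the [x_k] are arbitrary. *)
Lemma value_at0_sum (xs : 'rV[int]_e -> perp P) :
  value_at0 (fun m => \sum_(k <- K) Phi@_k * sval (xs k) m) =
  \sum_(k <- K) Psi@_k * value_at0 (sval (xs k)).
Proof.
have [phi_cont phi_act _] := phi_hom.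
have Pxs k : perp P (sval (xs k)) by exact: set_mem (svalP (xs k)).
have Py := perp_ca_sum K (fun k => Phi@_k) Pxs.
pose y : perp P := perp_elt Py.
have [R0 R0P] := continuous_finite_window y phi_cont.
have [Rs RsP] := choice (fun k => continuous_finite_window (xs k) phi_cont).
pose R := (R0 + \sum_(k <- K) Rs k)%N.
have RsR k : k \in K -> (Rs k <= R)%N.
  by move=> kK; rewrite /R (big_fsetD1 k) //= addnCA leq_addr.
have [N [x [Px xE]]] := perp_ca_gluing p_prime K R Phi_supp_neq0 Pxs.
pose X : perp P := perp_elt Px.
have QX : perp Q (sval (phi X)) by exact: set_mem (svalP (phi X)).
have act_at0 n : sval (phi (perp_act n X)) 0 = sval (phi X) (0 - n).
  by rewrite phi_act /= translateE.
have <- : sval (phi (perp_act (last_exp e.+1 *+ p ^ N) X)) 0 = value_at0 (sval y).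
  rewrite value_at0E; apply: R0P => n t nR tR /=; rewrite translateE.
  rewrite (perp_ca_frobenius p_prime Px) (@sum_msupp_sub _ _ _ K) ?fsubsetUl //.
  rewrite big_seq [RHS]big_seq; apply: eq_bigr => k kK; rewrite xE //.
    by rewrite (leq_trans nR) ?leq_addr.
  by rewrite (leq_trans tR) ?leq_addr.
rewrite act_at0 (perp_ca_frobenius p_prime QX) (@sum_msupp_sub _ _ _ K) ?fsubsetUr //.
rewrite big_seq [RHS]big_seq; apply: eq_bigr => k kK.
rewrite -act_at0 value_at0E; congr (_ * _); apply: RsP => n t nR tR.
rewrite /= translateE; apply: xE => //; first exact: leq_trans (RsR k kK).
exact: leq_trans (RsR k kK).
Qed.

Lemma value_at0_0 : value_at0 (fun=> 0) = 0.
Proof.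
have [_ _ phi0] := phi_hom.
by rewrite -[fun=> 0]/(sval (perp0 P)) value_at0E phi0.
Qed.

Lemma perp_comb (c d : 'F_p) (a b : series p e.+1) :
  perp P a -> perp P b -> perp P (fun m => c * a m + d * b m).
Proof.
move=> Pa Pb.
have := @perp_ca_sum p e Phi _ [:: true; false] (fun i => if i then c else d)
  (fun i => if i then a else b)
  (fun i => if i as i return perp P (if i then a else b) then Pa else Pb).
by congr (perp P _); apply/funext => m; rewrite !big_cons big_nil addr0.
Qed.

Lemma value_at0_two (a b : series p e.+1) k1 k2 :
  perp P a -> perp P b -> k1 \in K -> k2 \in K -> k1 != k2 ->
  value_at0 (fun m => Phi@_k1 * a m + Phi@_k2 * b m) =
  Psi@_k1 * value_at0 a + Psi@_k2 * value_at0 b.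
Proof.
move=> Pa Pb k1K k2K k12.
pose u : perp P := perp_elt Pa.
pose v : perp P := perp_elt Pb.
have := value_at0_sum (fun k =>
  if k == k1 then u else if k == k2 then v else perp0 P).
rewrite (big_fset_two k1K k2K k12) => [|k /negPf-> /negPf->]; last first.
  by rewrite value_at0_0 mulr0.
rewrite eqxx [k2 == k1]eq_sym (negPf k12) eqxx => <-.
congr value_at0; apply/funext => m.
rewrite (big_fset_two k1K k2K k12) => [|k /negPf-> /negPf->]; last by rewrite mulr0.
by rewrite eqxx [k2 == k1]eq_sym (negPf k12) eqxx.
Qed.

Lemma value_at0_eq0 : Phi <> Psi -> forall x, perp P x -> value_at0 x = 0.
Proof.
move=> neq x Px.
have [k kP] : exists k, Phi@_k <> Psi@_k.
  apply: contrapT => h; apply: neq; apply/malgP => k.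
  by apply: contrapT => kP; apply: h; exists k.
have kK : k \in K.
  rewrite inE -!mcoeff_neq0; apply/negPn; rewrite negb_or !negbK.
  by apply/negP => /andP[/eqP e1 /eqP e2]; apply: kP; rewrite e1 e2.
have [k2 k2P k2k] : exists2 k2, k2 \in msupp Phi & k2 != k.
  have /fset0Pn[k2] : (msupp Phi `\ k)%fset != fset0.
    rewrite -cardfs_gt0; have := cardfsD1 k (msupp Phi).
    by case: (k \in _) Phi_terms; lia.
  by rewrite !inE => /andP[? ?]; exists k2.
have k2K : k2 \in K by rewrite inE k2P.
have kk2 : k != k2 by rewrite eq_sym.
have P0 : perp P (fun=> 0) by exact: set_mem (perp_0 P).
have scale a : perp P a ->
    value_at0 (fun m => Phi@_k * a m) = Psi@_k * value_at0 a.
  move=> Pa; have := value_at0_two Pa P0 kK k2K kk2.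
  rewrite value_at0_0 !mulr0 addr0 => <-; congr value_at0.
  by apply/funext => m; rewrite addr0.
have scale2 b : perp P b ->
    value_at0 (fun m => Phi@_k2 * b m) = Psi@_k2 * value_at0 b.
  move=> Pb; have := value_at0_two P0 Pb kK k2K kk2.
  rewrite value_at0_0 !mulr0 add0r => <-; congr value_at0.
  by apply/funext => m; rewrite add0r.
have PZ c a : perp P a -> perp P (fun m => c * a m).
  move=> Pa; have := perp_comb c 0 Pa P0; congr (perp P _).
  by apply/funext => m; rewrite mulr0 addr0.
have [Phik0|Phik0] := eqVneq Phi@_k 0.
  have Psik0 : Psi@_k != 0 by apply/eqP => h; apply: kP; rewrite Phik0 h.
  apply: (mulfI Psik0); rewrite mulr0 -scale // -[RHS]value_at0_0.
  by congr value_at0; apply/funext => m; rewrite Phik0 mul0r.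
have PhiK j a : Phi@_j != 0 ->
    (fun m => Phi@_j * ((Phi@_j)^-1 * a m)) = a :> series p e.+1.
  by move=> j0; apply/funext => m; rewrite mulVKf.
have Phik20 : Phi@_k2 != 0 by rewrite mcoeff_neq0.
(* The relation at [k] and [k2] now reads
   [f(Phi_k a + Phi_k2 b) = f(Phi_k a) + f(Phi_k2 b)], with [Phi_k] and [Phi_k2]
   invertible. *)
have add a b : perp P a -> perp P b ->
    value_at0 (fun m => a m + b m) = value_at0 a + value_at0 b.
  move=> Pa Pb; rewrite -(PhiK _ a Phik0) -(PhiK _ b Phik20).
  rewrite (value_at0_two (PZ (Phi@_k)^-1 _ Pa) (PZ (Phi@_k2)^-1 _ Pb) kK k2K kk2).
  by rewrite scale ?scale2 //; apply: PZ.
have natZ n : value_at0 (fun m => n%:R * x m) = n%:R * value_at0 x.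
  elim: n => [|n IH].
    rewrite mul0r -[RHS]value_at0_0; congr value_at0.
    by apply/funext => m; rewrite mul0r.
  rewrite -[in RHS]natr1 mulrDl mul1r -IH -add //; last exact: PZ.
  by congr value_at0; apply/funext => m; rewrite -natr1 mulrDl mul1r.
have := scale x Px; rewrite -[in LHS](natr_Zp Phi@_k) natZ natr_Zp => /eqP.
rewrite -subr_eq0 -mulrBl mulf_eq0 subr_eq0 => /orP[/eqP/kP //|/eqP //].
Qed.

End Rigidity.

Theorem corollary14 (p : nat) (p_prime : prime p) (d : nat) (d_ge2 : (2 <= d)%N)
  (Phi Psi : laurent p d.-1)
  (Phi_terms : (2 <= #|` msupp Phi|)%N) (Psi_terms : (2 <= #|` msupp Psi|)%N)
  (P : laurent p d) (P_def : P = ca_poly Phi)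
  (Q : laurent p d) (Q_def : Q = ca_poly Psi)
  (P_neq_Q : P <> Q)
  (phi : perp P -> perp Q) (phi_hom : topological_hom phi) :
  forall x : perp P, phi x = perp0 Q.
Proof.
case: d d_ge2 Phi Psi Phi_terms Psi_terms P P_def Q Q_def P_neq_Q
  phi phi_hom => // e _.
move=> Phi Psi Phi_terms _ P -> Q -> neq phi phi_hom x.
have PhiPsi : Phi <> Psi by move=> h; apply: neq; rewrite h.
apply: val_inj; apply/funext => n.
have [_ phi_act _] := phi_hom.
have := value_at0_eq0 p_prime Phi_terms phi_hom PhiPsi
  (set_mem (svalP (perp_act (- n) x))).
by rewrite value_at0E phi_act /= translateE sub0r opprK.
Qed.
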